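(* Let $\mathbb H$ be the division ring of quaternions over the real field with basis $e_0=1,e_1=i,e_2=j,e_3=k$, let $x\mapsto y=y(x)$ be a map $\mathbb H\to\mathbb H$ differentiable in the Gâteaux sense, let $\left(\frac{\partial y^{p}}{\partial x^{q}}\right)$ be its Jacobian matrix over the real field, and let $D^{pq}=\frac{\partial^{pq}y}{\partial x}$ denote the standard components of its Gâteaux differential. Then: (0) $\frac{\partial y^0}{\partial x^0}=D^{00}-D^{11}-D^{22}-D^{33}$, $\frac{\partial y^1}{\partial x^1}=D^{00}-D^{11}+D^{22}+D^{33}$, $\frac{\partial y^2}{\partial x^2}=D^{00}+D^{11}-D^{22}+D^{33}$, $\frac{\partial y^3}{\partial x^3}=D^{00}+D^{11}+D^{22}-D^{33}$; (1) $\frac{\partial y^1}{\partial x^0}=D^{01}+D^{10}+D^{23}-D^{32}$, $\frac{\partial y^0}{\partial x^1}=-D^{01}-D^{10}+D^{23}-D^{32}$, $\frac{\partial y^3}{\partial x^2}=-D^{01}+D^{10}-D^{23}-D^{32}$, $\frac{\partial y^2}{\partial x^3}=D^{01}-D^{10}-D^{23}-D^{32}$; (2) $\frac{\partial y^2}{\partial x^0}=D^{02}-D^{13}+D^{20}+D^{31}$, $\frac{\partial y^3}{\partial x^1}=D^{02}-D^{13}-D^{20}-D^{31}$, $\frac{\partial y^0}{\partial x^2}=-D^{02}-D^{13}-D^{20}+D^{31}$, $\frac{\partial y^1}{\partial x^3}=-D^{02}-D^{13}+D^{20}-D^{31}$; (3) $\frac{\partial y^3}{\partial x^0}=D^{03}+D^{12}-D^{21}+D^{30}$,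 $\frac{\partial y^2}{\partial x^1}=-D^{03}-D^{12}-D^{21}+D^{30}$, $\frac{\partial y^1}{\partial x^2}=D^{03}-D^{12}-D^{21}-D^{30}$, $\frac{\partial y^0}{\partial x^3}=-D^{03}+D^{12}-D^{21}-D^{30}$; and conversely (0') $4D^{00}=\frac{\partial y^0}{\partial x^0}+\frac{\partial y^1}{\partial x^1}+\frac{\partial y^2}{\partial x^2}+\frac{\partial y^3}{\partial x^3}$, $4D^{11}=-\frac{\partial y^0}{\partial x^0}-\frac{\partial y^1}{\partial x^1}+\frac{\partial y^2}{\partial x^2}+\frac{\partial y^3}{\partial x^3}$, $4D^{22}=-\frac{\partial y^0}{\partial x^0}+\frac{\partial y^1}{\partial x^1}-\frac{\partial y^2}{\partial x^2}+\frac{\partial y^3}{\partial x^3}$, $4D^{33}=-\frac{\partial y^0}{\partial x^0}+\frac{\partial y^1}{\partial x^1}+\frac{\partial y^2}{\partial x^2}-\frac{\partial y^3}{\partial x^3}$; (1') $4D^{10}=-\frac{\partial y^0}{\partial x^1}+\frac{\partial y^1}{\partial x^0}-\frac{\partial y^2}{\partial x^3}+\frac{\partial y^3}{\partial x^2}$, $4D^{01}=-\frac{\partial y^0}{\partial x^1}+\frac{\partial y^1}{\partial x^0}+\frac{\partial y^2}{\partial x^3}-\frac{\partial y^3}{\partial x^2}$, $4D^{32}=-\frac{\partial y^0}{\partial x^1}-\frac{\partial y^1}{\partial x^0}-\frac{\partial y^2}{\partial x^3}-\frac{\partial y^3}{\partial x^2}$, $4D^{23}=\frac{\partial y^0}{\partial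 x^1}+\frac{\partial y^1}{\partial x^0}-\frac{\partial y^2}{\partial x^3}-\frac{\partial y^3}{\partial x^2}$; (2') $4D^{20}=-\frac{\partial y^0}{\partial x^2}+\frac{\partial y^1}{\partial x^3}+\frac{\partial y^2}{\partial x^0}-\frac{\partial y^3}{\partial x^1}$, $4D^{31}=\frac{\partial y^0}{\partial x^2}-\frac{\partial y^1}{\partial x^3}+\frac{\partial y^2}{\partial x^0}-\frac{\partial y^3}{\partial x^1}$, $4D^{02}=-\frac{\partial y^0}{\partial x^2}-\frac{\partial y^1}{\partial x^3}+\frac{\partial y^2}{\partial x^0}+\frac{\partial y^3}{\partial x^1}$, $4D^{13}=-\frac{\partial y^0}{\partial x^2}-\frac{\partial y^1}{\partial x^3}-\frac{\partial y^2}{\partial x^0}-\frac{\partial y^3}{\partial x^1}$; (3') $4D^{30}=-\frac{\partial y^0}{\partial x^3}-\frac{\partial y^1}{\partial x^2}+\frac{\partial y^2}{\partial x^1}+\frac{\partial y^3}{\partial x^0}$, $4D^{21}=-\frac{\partial y^0}{\partial x^3}-\frac{\partial y^1}{\partial x^2}-\frac{\partial y^2}{\partial x^1}-\frac{\partial y^3}{\partial x^0}$, $4D^{12}=\frac{\partial y^0}{\partial x^3}-\frac{\partial y^1}{\partial x^2}-\frac{\partial y^2}{\partial x^1}+\frac{\partial y^3}{\partial x^0}$, $4D^{03}=-\frac{\partial y^0}{\partial x^3}+\frac{\partial y^1}{\partial x^2}-\frac{\partial y^2}{\partial x^1}+\frac{\partial y^3}{\partial x^0}$.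
   Context: $\mathbb H$ has $i^2=j^2=k^2=-1$, $ij=k=-ji$, $jk=i=-kj$, $ki=j=-ik$ and the usual norm $|x|$. A map $y:\mathbb H\to\mathbb H$ is differentiable in the Gâteaux sense if at every $x$ one has $y(x+a)-y(x)=\partial y(x)(a)+o(a)$ with $a\mapsto\partial y(x)(a)$ linear over the center $\mathbb R$ and $o$ a continuous map with $|o(a)|/|a|\to0$ as $a\to0$. The Jacobian entries are the real functions defined by $\partial y(x)\big(\sum_q a^qe_q\big)=\sum_{p,q}a^q\frac{\partial y^p}{\partial x^q}e_p$, $a^q\in\mathbb R$ (where $x=\sum_q x^qe_q$, $y=\sum_p y^pe_p$). The standard components $\frac{\partial^{pq}y}{\partial x}\in\mathbb R$ of the Gâteaux differential are the coefficients in $\partial y(x)(a)=\sum_{p,q}\frac{\partial^{pq}y}{\partial x}\,e_p\,a\,e_q$. *)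

(* Defs.v *)
From HB Require Import structures.
From mathcomp Require Import all_boot all_order all_algebra.
From mathcomp Require Import ring lra.
From mathcomp Require Import boolp classical_sets reals topology normedtype.

Set Implicit Arguments.
Unset Strict Implicit.
Unset Printing Implicit Defensive.

Import Order.TTheory GRing.Theory Num.Theory.
Import numFieldNormedType.Exports.

Local Open Scope classical_set_scope.
Local Open Scope ring_scope.

Record quat (R : Type) := Quat { quat0 : R; quat1 : R; quat2 : R; quat3 : R }.

Section QuatChoice.
Variable R : Type.

Definition tuple_of_quat (x : quat R) :=
  (quat0 x, quat1 x, quat2 x, quat3 x).

Definition quat_of_tuple (t : R * R * R * R) :=
  let: (a, b, c, d) := t in Quat a b c d.

Lemma tuple_of_quatK : cancel tuple_of_quat quat_of_tuple.
Proof. by case. Qed.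

End QuatChoice.

HB.instance Definition _ (R : choiceType) :=
  Choice.copy (quat R) (can_type (@tuple_of_quatK R)).

Section QuatAlgebra.
Variable R : realType.
Implicit Types (x y z : quat R) (a b : R).

Lemma quat_ext x y : quat0 x = quat0 y -> quat1 x = quat1 y ->
  quat2 x = quat2 y -> quat3 x = quat3 y -> x = y.
Proof. by case: x y => ? ? ? ? [] ? ? ? ? /= -> -> -> ->. Qed.

Definition addq x y := Quat (quat0 x + quat0 y) (quat1 x + quat1 y)
  (quat2 x + quat2 y) (quat3 x + quat3 y).

Definition oppq x := Quat (- quat0 x) (- quat1 x) (- quat2 x) (- quat3 x).

Definition zeroq : quat R := Quat 0 0 0 0.

Lemma addqA : associative addq.
Proof. by move=> x y z; apply: quat_ext; rewrite /= addrA. Qed.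

Lemma addqC : commutative addq.
Proof. by move=> x y; apply: quat_ext; rewrite /= addrC. Qed.

Lemma add0q : left_id zeroq addq.
Proof. by move=> x; apply: quat_ext; rewrite /= add0r. Qed.

Lemma addNq : left_inverse zeroq oppq addq.
Proof. by move=> x; apply: quat_ext; rewrite /= addNr. Qed.

HB.instance Definition _ :=
  GRing.isZmodule.Build (quat R) addqA addqC add0q addNq.

Definition oneq : quat R := Quat 1 0 0 0.
Definition qi : quat R := Quat 0 1 0 0.
Definition qj : quat R := Quat 0 0 1 0.
Definition qk : quat R := Quat 0 0 0 1.

Definition mulq x y :=
  let: Quat x0 x1 x2 x3 := x in
  let: Quat y0 y1 y2 y3 := y in
  Quat (x0 * y0 - x1 * y1 - x2 * y2 - x3 * y3)
       (x0 * y1 + x1 * y0 + x2 * y3 - x3 * y2)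
       (x0 * y2 - x1 * y3 + x2 * y0 + x3 * y1)
       (x0 * y3 + x1 * y2 - x2 * y1 + x3 * y0).

Lemma mulqA : associative mulq.
Proof.
by move=> [? ? ? ?] [? ? ? ?] [? ? ? ?]; apply: quat_ext => /=; ring.
Qed.

Lemma mul1q : left_id oneq mulq.
Proof. by move=> [? ? ? ?]; apply: quat_ext => /=; ring. Qed.

Lemma mulq1 : right_id oneq mulq.
Proof. by move=> [? ? ? ?]; apply: quat_ext => /=; ring. Qed.

Lemma mulqDl : left_distributive mulq addq.
Proof.
by move=> [? ? ? ?] [? ? ? ?] [? ? ? ?]; apply: quat_ext => /=; ring.
Qed.

Lemma mulqDr : right_distributive mulq addq.
Proof.
by move=> [? ? ? ?] [? ? ? ?] [? ? ? ?]; apply: quat_ext => /=; ring.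
Qed.

Lemma oneq_neq0 : oneq != 0.
Proof. by apply/eqP => -[] /eqP; rewrite oner_eq0. Qed.

HB.instance Definition _ := GRing.Zmodule_isNzRing.Build (quat R)
  mulqA mul1q mulq1 mulqDl mulqDr oneq_neq0.

Lemma qi2 : qi * qi = -1.
Proof. by apply: quat_ext => /=; ring. Qed.

Lemma qj2 : qj * qj = -1.
Proof. by apply: quat_ext => /=; ring. Qed.

Lemma qk2 : qk * qk = -1.
Proof. by apply: quat_ext => /=; ring. Qed.

Lemma qij : (qi * qj = qk) * (qj * qi = - qk).
Proof. by split; apply: quat_ext => /=; ring. Qed.

Lemma qjk : (qj * qk = qi) * (qk * qj = - qi).
Proof. by split; apply: quat_ext => /=; ring. Qed.

Lemma qki : (qk * qi = qj) * (qi * qk = - qj).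
Proof. by split; apply: quat_ext => /=; ring. Qed.

Definition scaleq a x := Quat (a * quat0 x) (a * quat1 x)
  (a * quat2 x) (a * quat3 x).

Lemma scaleqA a b x : scaleq a (scaleq b x) = scaleq (a * b) x.
Proof. by apply: quat_ext; rewrite /= mulrA. Qed.

Lemma scale1q : left_id 1 scaleq.
Proof. by move=> x; apply: quat_ext; rewrite /= mul1r. Qed.

Lemma scaleqDr : right_distributive scaleq +%R.
Proof. by move=> a x y; apply: quat_ext; rewrite /= mulrDr. Qed.

Lemma scaleqDl x : {morph scaleq^~ x : a b / a + b}.
Proof. by move=> a b; apply: quat_ext; rewrite /= mulrDl. Qed.

HB.instance Definition _ := GRing.Zmodule_isLmodule.Build R (quat R)
  scaleqA scale1q scaleqDr scaleqDl.

Lemma scaleqAl a x y : a *: (x * y) = (a *: x) * y.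
Proof. by case: x y => [? ? ? ?] [? ? ? ?]; apply: quat_ext => /=; ring. Qed.

HB.instance Definition _ :=
  GRing.Lmodule_isLalgebra.Build R (quat R) scaleqAl.

Lemma scaleqAr a x y : a *: (x * y) = x * (a *: y).
Proof. by case: x y => [? ? ? ?] [? ? ? ?]; apply: quat_ext => /=; ring. Qed.

HB.instance Definition _ :=
  GRing.Lalgebra_isAlgebra.Build R (quat R) scaleqAr.

Definition sqnormq x := quat0 x ^+ 2 + quat1 x ^+ 2 + quat2 x ^+ 2 + quat3 x ^+ 2.

Lemma sqnormq_ge0 x : 0 <= sqnormq x.
Proof. by rewrite !addr_ge0 ?sqr_ge0. Qed.

Lemma sqnormq_eq0 x : (sqnormq x == 0) = (x == 0).
Proof.
apply/eqP/eqP => [|->]; last by rewrite /sqnormq /= expr0n /= !addr0.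
move/eqP; rewrite /sqnormq !paddr_eq0 ?addr_ge0 ?sqr_ge0// !sqrf_eq0.
by move=> /andP[/andP[/andP[/eqP ? /eqP ?] /eqP ?] /eqP ?]; apply: quat_ext.
Qed.

Definition conjq x := Quat (quat0 x) (- quat1 x) (- quat2 x) (- quat3 x).

Definition unitq : pred (quat R) := fun x => x != 0.

Definition invq x := (sqnormq x)^-1 *: conjq x.

Lemma mulVq : {in unitq, left_inverse 1 invq *%R}.
Proof.
move=> x; rewrite unfold_in -sqnormq_eq0 /invq /sqnormq.
case: x => a b c d /= nz.
by apply: quat_ext => /=; field.
Qed.

Lemma mulqV : {in unitq, right_inverse 1 invq *%R}.
Proof.
move=> x; rewrite unfold_in -sqnormq_eq0 /invq /sqnormq.
case: x => a b c d /= nz.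
by apply: quat_ext => /=; field.
Qed.

Lemma unitqP x y : y * x = 1 /\ x * y = 1 -> unitq x.
Proof.
move=> [yx1 _]; apply/eqP => x0; move/eqP: yx1.
by rewrite x0 mulr0 eq_sym oner_eq0.
Qed.

Lemma invq_out : {in [predC unitq], invq =1 id}.
Proof.
move=> x; rewrite inE /= unfold_in negbK => /eqP ->.
by apply: quat_ext; rewrite /= ?oppr0 mulr0.
Qed.

HB.instance Definition _ := GRing.NzRing_hasMulInverse.Build (quat R)
  mulVq mulqV unitqP invq_out.

Lemma quat_unitE x : (x \is a GRing.unit) = (x != 0).
Proof. by []. Qed.

Definition normq x : R := Num.sqrt (sqnormq x).

Lemma normqZ a x : normq (a *: x) = `|a| * normq x.
Proof.
rewrite /normq -sqrtr_sqr -sqrtrM ?sqr_ge0//; congr Num.sqrt.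
by rewrite /sqnormq /=; ring.
Qed.

Lemma normq_eq0 x : normq x = 0 -> x = 0.
Proof.
move/eqP; rewrite sqrtr_eq0 => le0; apply/eqP.
by rewrite -sqnormq_eq0 eq_le le0 sqnormq_ge0.
Qed.

Lemma ler_normqD x y : normq (x + y) <= normq x + normq y.
Proof.
have [nx ny] : 0 <= normq x /\ 0 <= normq y by rewrite !sqrtr_ge0.
rewrite -(@ler_pXn2r _ 2) ?nnegrE ?sqrtr_ge0 ?addr_ge0//.
rewrite sqr_sqrtr ?sqnormq_ge0// sqrrD !sqr_sqrtr ?sqnormq_ge0//.
pose s := quat0 x * quat0 y + quat1 x * quat1 y
  + quat2 x * quat2 y + quat3 x * quat3 y.
suff : s <= normq x * normq y.
  by rewrite /sqnormq /s /=; set u := normq x * normq y; lra.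
apply: le_trans (ler_norm s) _; rewrite -sqrtrM ?sqnormq_ge0// -sqrtr_sqr.
rewrite ler_sqrt ?mulr_ge0 ?sqnormq_ge0// -subr_ge0.
have -> : sqnormq x * sqnormq y - s ^+ 2 =
    (quat0 x * quat1 y - quat1 x * quat0 y) ^+ 2
  + (quat0 x * quat2 y - quat2 x * quat0 y) ^+ 2
  + (quat0 x * quat3 y - quat3 x * quat0 y) ^+ 2
  + (quat1 x * quat2 y - quat2 x * quat1 y) ^+ 2
  + (quat1 x * quat3 y - quat3 x * quat1 y) ^+ 2
  + (quat2 x * quat3 y - quat3 x * quat2 y) ^+ 2.
  by rewrite /sqnormq /s; ring.
by rewrite !addr_ge0 ?sqr_ge0.
Qed.

HB.instance Definition _ := Lmodule_isNormed.Build R (quat R)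
  ler_normqD normqZ normq_eq0.

Definition quat_basis (p : 'I_4) : quat R := [:: 1; qi; qj; qk]`_p.

End QuatAlgebra.

Section GateauxDifferential.
Variable R : realType.
Local Notation H := (quat R).
Local Notation e := (@quat_basis R).
Implicit Types (y d : H -> H) (x : H) (J D : 'M[R]_4).

Definition is_gateaux_differential y x d :=
  linear d /\
  exists o : H -> H,
    [/\ continuous o,
        `|o a| / `|a| @[a --> (0 : H)^'] --> (0 : R)
      & forall a, y (x + a) - y x = d a + o a].

Definition gateaux_differentiable y :=
  forall x, exists d, is_gateaux_differential y x d.

(* [get] is Hilbert's choice: here and below it picks the (unique) object with
   the stated property, and a default value if there is none. *)
Definition gateaux_differential y x : H -> H :=
  get [set d | is_gateaux_differential y x d].

(* J p q is the derivative of the p-th coordinate of y along the q-th one of x. *)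
Definition is_jacobian_matrix d J :=
  forall a : 'I_4 -> R,
    d (\sum_q a q *: e q) = \sum_p \sum_q (a q * J p q) *: e p.

Definition jacobian_matrix y x : 'M[R]_4 :=
  get [set J | is_jacobian_matrix (gateaux_differential y x) J].

Definition is_standard_components d D :=
  forall a : H, d a = \sum_p \sum_q D p q *: (e p * a * e q).

Definition standard_components y x : 'M[R]_4 :=
  get [set D | is_standard_components (gateaux_differential y x) D].

End GateauxDifferential.

(* Main.v *)
Require Import Defs.
From HB Require Import structures.
From mathcomp Require Import all_boot all_order all_algebra.
From mathcomp Require Import reals.
From mathcomp Require Import ring.
From mathcomp Require Import classical_sets.

Set Implicit Arguments.
Unset Strict Implicit.
Unset Printing Implicit Defensive.

Import GRing.Theory.

Local Open Scope ring_scope.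

(** A Gateaux differential [d] is in particular an [R]-linear endomorphism of
    the quaternions, and the relations are the change of coordinates between
    two bases of the 16-dimensional space of such endomorphisms: the matrix
    units, whose coefficients form the Jacobian matrix, and the maps
    [a |-> e p * a * e q], whose coefficients are the standard components.

    Both families of coefficients exist.  For the Jacobian matrix this is the
    expansion of a linear map on a basis ([linear_is_jacobian_matrix]).  For the
    standard components, the maps [a |-> e p * a * e q] are pairwise orthogonal
    for the trace inner product, each of square norm 4; hence the coefficient of
    [d] along each of them is one quarter of its inner product with it
    ([linear_is_standard_components]).

    Existence implies that the matrices chosen in the definitions satisfy their
    defining equations.  Evaluating both expansions at [a = e q] expresses column
    [q] of the Jacobian matrix through the standard components
    ([jacobian_column_standard]); the sixteen resulting scalar equations are the
    direct relations, and signed sums of four of them are the converse ones. *)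

Section QuatCoordinates.
Variable R : realType.
Local Notation H := (quat R).
Local Notation e := (@quat_basis R).
Implicit Types (d : H -> H) (J D : 'M[R]_4).

(** The numerals on the right are elements of the ring ['I_4], as in the
    matrix entries to be computed. *)
Lemma sum_ord4 (V : zmodType) (F : 'I_4 -> V) :
  \sum_p F p = F 0 + F 1 + F 2 + F 3.
Proof.
rewrite !big_ord_recl big_ord0 addr0 !addrA.
by congr (F _ + F _ + F _ + F _); apply: val_inj.
Qed.

Lemma quat_basisE : (e 0 = 1) * (e 1 = qi R) * (e 2 = qj R) * (e 3 = qk R).
Proof. by []. Qed.

Lemma sum_quat_basis (c : 'I_4 -> R) :
  \sum_p c p *: e p = Quat (c 0) (c 1) (c 2) (c 3).
Proof. by rewrite sum_ord4 !quat_basisE; apply: quat_ext => /=; ring. Qed.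

Definition quat_coord (p : 'I_4) (x : H) : R :=
  [:: quat0 x; quat1 x; quat2 x; quat3 x]`_p.

Lemma quat_basis_expansion (x : H) : x = \sum_p quat_coord p x *: e p.
Proof. by rewrite sum_quat_basis; case: x. Qed.

Definition dotq (x y : H) : R := \sum_p quat_coord p x * quat_coord p y.

Lemma linear_sum_quat_basis d (a : 'I_4 -> R) : linear d ->
  d (\sum_q a q *: e q) = \sum_q a q *: d (e q).
Proof.
move=> lin_d.
pose f := HB.pack_for {linear H -> H} d (GRing.isLinear.Build R H H *:%R d lin_d).
rewrite -[d]/(f : H -> H) linear_sum; apply: eq_bigr => q _; exact: linearZ.
Qed.

Lemma linear_is_jacobian_matrix d : linear d ->
  is_jacobian_matrix d (\matrix_(p, q) quat_coord p (d (e q))).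
Proof.
move=> lin_d a; rewrite linear_sum_quat_basis // (eq_bigr (fun q =>
  \sum_p (a q * quat_coord p (d (e q))) *: e p)) => [|q _].
  by rewrite exchange_big; apply: eq_bigr => p _; apply: eq_bigr => q _; rewrite mxE.
rewrite [d (e q) in LHS]quat_basis_expansion scaler_sumr.
by apply: eq_bigr => p _; rewrite scalerA.
Qed.

(** The trace of [a |-> u * a * v] is four times the product of the real parts
    of [u] and [v], and the adjoint of [a |-> e p * a * e q] is the two-sided
    multiplication by the conjugates of [e p] and [e q].  So these sixteen maps
    are orthogonal of square norm 4, hence a basis, and the entries below are
    the coefficients of the orthogonal projections of [d] on them. *)
Lemma linear_is_standard_components d : linear d ->
  is_standard_components d
    (\matrix_(p, q) (4^-1 * \sum_r dotq (e p * e r * e q) (d (e r)))).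
Proof.
move=> lin_d a.
rewrite [in LHS](quat_basis_expansion a) linear_sum_quat_basis //.
rewrite !sum_ord4 !mxE /dotq !sum_ord4 !quat_basisE.
case: (d 1) (d (qi R)) (d (qj R)) (d (qk R)) => u0 u1 u2 u3.
move=> [v0 v1 v2 v3] [w0 w1 w2 w3] [z0 z1 z2 z3].
(* An identity in the coordinates of [a] and of the four values [d (e r)],
   which are arbitrary. *)
by case: a => a0 a1 a2 a3; apply: quat_ext; rewrite /quat_coord /=; field.
Qed.

(** Testing the defining equation on the indicator of [q] isolates a column. *)
Lemma jacobian_column d J q : is_jacobian_matrix d J ->
  d (e q) = Quat (J 0 q) (J 1 q) (J 2 q) (J 3 q).
Proof.
move=> dJ; have := dJ (fun r => (r == q)%:R).
rewrite (bigD1 q) //= eqxx scale1r big1 ?addr0 => [->|r /negPf ->]; last first.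
  by rewrite scale0r.
rewrite -[RHS](sum_quat_basis (J ^~ q)); apply: eq_bigr => p _.
rewrite (bigD1 q) //= eqxx mul1r big1 ?addr0 // => r /negPf ->.
by rewrite mul0r scale0r.
Qed.

(** The source of all the relations: as each product [e p * e q * e r] is a
    basis quaternion up to sign, the coordinates of the right-hand side are
    signed sums of four entries of [D]. *)
Lemma jacobian_column_standard d J D q :
    is_jacobian_matrix d J -> is_standard_components d D ->
  Quat (J 0 q) (J 1 q) (J 2 q) (J 3 q) =
    \sum_p \sum_r D p r *: (e p * e q * e r).
Proof. by move=> dJ dD; rewrite -(jacobian_column q dJ) dD. Qed.

End QuatCoordinates.

Lemma gateaux_differential_linear (R : realType) (y : quat R -> quat R) x :
  gateaux_differentiable y -> linear (gateaux_differential y x).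
Proof.
by move=> hy; have [d yd] := hy x; have [] := getPex (ex_intro _ d yd : exists d,
  [set d | is_gateaux_differential y x d]%classic d).
Qed.

(** Hilbert's choice returns a solution because linearity provides one. *)
Lemma jacobian_matrixP (R : realType) (y : quat R -> quat R) x :
  gateaux_differentiable y ->
  is_jacobian_matrix (gateaux_differential y x) (jacobian_matrix y x).
Proof.
move=> hy; rewrite /jacobian_matrix.
exact: (getI (linear_is_jacobian_matrix (gateaux_differential_linear x hy))).
Qed.

Lemma standard_componentsP (R : realType) (y : quat R -> quat R) x :
  gateaux_differentiable y ->
  is_standard_components (gateaux_differential y x) (standard_components y x).
Proof.
move=> hy; rewrite /standard_components.
exact: (getI (linear_is_standard_components (gateaux_differential_linear x hy))).
Qed.

Theorem theorem14p1 (R : realType) (y : quat R -> quat R)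
    (hy : gateaux_differentiable y) (x : quat R) :
  let J := jacobian_matrix y x in
  let D := standard_components y x in
  [/\ J 0 0 = D 0 0 - D 1 1 - D 2 2 - D 3 3,
      J 1 1 = D 0 0 - D 1 1 + D 2 2 + D 3 3,
      J 2 2 = D 0 0 + D 1 1 - D 2 2 + D 3 3
    & J 3 3 = D 0 0 + D 1 1 + D 2 2 - D 3 3] /\
  [/\ J 1 0 = D 0 1 + D 1 0 + D 2 3 - D 3 2,
      J 0 1 = - D 0 1 - D 1 0 + D 2 3 - D 3 2,
      J 3 2 = - D 0 1 + D 1 0 - D 2 3 - D 3 2
    & J 2 3 = D 0 1 - D 1 0 - D 2 3 - D 3 2] /\
  [/\ J 2 0 = D 0 2 - D 1 3 + D 2 0 + D 3 1,
      J 3 1 = D 0 2 - D 1 3 - D 2 0 - D 3 1,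
      J 0 2 = - D 0 2 - D 1 3 - D 2 0 + D 3 1
    & J 1 3 = - D 0 2 - D 1 3 + D 2 0 - D 3 1] /\
  [/\ J 3 0 = D 0 3 + D 1 2 - D 2 1 + D 3 0,
      J 2 1 = - D 0 3 - D 1 2 - D 2 1 + D 3 0,
      J 1 2 = D 0 3 - D 1 2 - D 2 1 - D 3 0
    & J 0 3 = - D 0 3 + D 1 2 - D 2 1 - D 3 0] /\
  [/\ 4 * D 0 0 = J 0 0 + J 1 1 + J 2 2 + J 3 3,
      4 * D 1 1 = - J 0 0 - J 1 1 + J 2 2 + J 3 3,
      4 * D 2 2 = - J 0 0 + J 1 1 - J 2 2 + J 3 3
    & 4 * D 3 3 = - J 0 0 + J 1 1 + J 2 2 - J 3 3] /\
  [/\ 4 * D 1 0 = - J 0 1 + J 1 0 - J 2 3 + J 3 2,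
      4 * D 0 1 = - J 0 1 + J 1 0 + J 2 3 - J 3 2,
      4 * D 3 2 = - J 0 1 - J 1 0 - J 2 3 - J 3 2
    & 4 * D 2 3 = J 0 1 + J 1 0 - J 2 3 - J 3 2] /\
  [/\ 4 * D 2 0 = - J 0 2 + J 1 3 + J 2 0 - J 3 1,
      4 * D 3 1 = J 0 2 - J 1 3 + J 2 0 - J 3 1,
      4 * D 0 2 = - J 0 2 - J 1 3 + J 2 0 + J 3 1
    & 4 * D 1 3 = - J 0 2 - J 1 3 - J 2 0 - J 3 1] /\
  [/\ 4 * D 3 0 = - J 0 3 - J 1 2 + J 2 1 + J 3 0,
      4 * D 2 1 = - J 0 3 - J 1 2 - J 2 1 - J 3 0,
      4 * D 1 2 = J 0 3 - J 1 2 - J 2 1 + J 3 0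
    & 4 * D 0 3 = - J 0 3 + J 1 2 - J 2 1 + J 3 0].
Proof.
move=> J D.
have col q := jacobian_column_standard q (jacobian_matrixP x hy)
  (standard_componentsP x hy).
rewrite -/J -/D in col; clearbody J D.
have := col 3; have := col 2; have := col 1; have := col 0.
rewrite !sum_ord4 !quat_basisE /=.
(* Every Jacobian entry is replaced by its combination of standard components:
   both the direct and the converse relations become identities in [D]. *)
do 4![case => -> -> -> ->].
by do 7?[split; first by split; ring]; split; ring.
Qed.
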